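(* Let \[ n=d\,2^{\left\lfloor \frac{(\ln d)^2}{2\ln 2}\right\rfloor}. \] As $d\to\infty$, there exists a family of admissible recursion leaves (of the pair $(d,n)$) whose total contribution is at least \[ (n-d)^{\log_2\left((4\ln 2+o(1))\frac{d}{(\ln d)^2}\right)}. \] Consequently, the leading constant $4\ln 2$ in the general curved-path bound cannot be improved by a more accurate positive count of the same recursion leaves.
   Context: A polyhedron is a finite intersection of closed half-spaces; it is pointed if it has at least one vertex. The graph of a pointed polyhedron has its vertices as nodes, two of them being adjacent if they are the endpoints of a bounded edge of the polyhedron; the diameter of the polyhedron is the diameter of this graph. $\Delta_u(d,n)$ denotes the maximum diameter of a pointed $d$-dimensional polyhedron with $n$ facets. Recursion leaves. For $n\geq d\geq 3$ one has the known inequality $\Delta_u(d,n)\leq\sum_{i=0}^{\lfloor\log_2(n/d)\rfloor}2^i\Delta_u(d-1,\lfloor n/2^i\rfloor)-1$. Iterate it from $(d,n)$, with $n\ge d\ge 4$, discarding the negative internal terms $-1$, until only dimension-three terms remain. Each branch of this expansion is given by an admissible index vector $(i_d,i_{d-1},\dots,i_4)$ of nonnegative integers, where $i_q$ is the summation index chosen when the inequality is applied at dimension $q$; admissible means that each $i_q$ lies in the corresponding summation range, i.e. $0\le i_q\le\lfloor\log_2(m/q)\rfloor$, where $m=\lfloor n/2^{i_d+\cdots+i_{q+1}}\rfloor$ is the current number of facets. The terminal dimension-three term reached by a branch is its (admissible) recursion leaf; different branches give distinct leaves. With $J=\sum_{q=4}^d i_q$, the contribution of the leaf is $2^J\Delta_u(3,\lfloor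 n/2^J\rfloor)$. The total contribution of a family of leaves is the sum of their contributions. A positive count of the recursion leaves means an upper estimate of the number, and hence the total contribution, of the leaves remaining after the negative terms have been discarded; the sharpness assertion concerns only this counting argument and is not a lower bound on $\Delta_u(d,n)$. The general curved-path bound is the following statement: there exists a sequence $G_d$, depending only on $d$, such that for every $n\geq d\geq 4$, \[ \Delta_u(d,n)\leq (n-d)^{\log_2 G_d},\qquad G_d=(4\ln 2+o(1))\frac{d}{(\ln d)^2}, \] where the asymptotic expression for $G_d$ is understood as $d\to\infty$. For $n\ge 2d$ (which covers the choice of $n$ in the claim for all large $d$) it is obtained by such a positive count of the recursion leaves of $(d,n)$. *)

(* Defs.v *)
From HB Require Import structures.
From mathcomp Require Import all_boot all_order all_algebra.
From mathcomp Require Import all_classical all_reals all_analysis.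
Set Implicit Arguments. Unset Strict Implicit. Unset Printing Implicit Defensive.
Import Order.TTheory GRing.Theory Num.Theory.
Import numFieldNormedType.Exports.
Local Open Scope classical_set_scope.
Local Open Scope ring_scope.

Section Polyhedra.
Variables (R : realType) (N : nat).
Implicit Types (P F S : set 'rV[R]_N) (u v : 'rV[R]_N).

Definition dot u v : R := \sum_(i < N) u 0 i * v 0 i.

Definition polyhedron P := exists hs : seq ('rV[R]_N * R),
  (forall h, h \in hs -> h.1 != 0) /\
  P = [set x | forall h, h \in hs -> dot h.1 x <= h.2].

(* [S] is nonempty and its affine hull has dimension [k]: [x0] together with
   the points [x0 + row i A] is an affine basis of the hull, contained in [S]. *)
Definition affdim S (k : nat) :=
  exists (x0 : 'rV[R]_N) (A : 'M[R]_(k, N)),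
    [/\ row_free A, S x0, (forall i, S (x0 + row i A)) &
        forall x, S x -> (x - x0 <= A)%MS].

(* [c = 0] is allowed: the empty set and [P] itself are (improper) faces. *)
Definition face P F := exists (c : 'rV[R]_N) (b : R),
  (forall x, P x -> dot c x <= b) /\ F = [set x | P x /\ dot c x = b].

Definition vertex P v := face P [set v].

Definition edge P F := face P F /\ affdim F 1.

Definition facet P F := face P F /\ exists k, affdim P k.+1 /\ affdim F k.

Definition pointed P := exists v, vertex P v.

Definition segment u v : set 'rV[R]_N :=
  [set x | exists2 t : R, 0 <= t <= 1 & x = (1 - t) *: u + t *: v].

(* A bounded edge with distinct endpoints [u] and [v] is an edge that is the
   segment from [u] to [v]. *)
Definition adjacent P u v :=
  [/\ vertex P u, vertex P v, u <> v & edge P (segment u v)].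

Definition walk P u v (k : nat) := exists p : nat -> 'rV[R]_N,
  [/\ p 0%N = u, p k = v & forall i, (i < k)%N -> adjacent P (p i) (p i.+1)].

(* [+oo] if [v] is not reachable from [u]. *)
Definition graph_dist P u v : \bar R :=
  ereal_inf [set k%:R%:E | k in walk P u v].

Definition diameter P : \bar R :=
  ereal_sup [set y | exists u v,
    [/\ vertex P u, vertex P v & y = graph_dist P u v]].

End Polyhedra.

Section Leaves.
Variable R : realType.

(* The maximum diameter of a pointed [d]-dimensional polyhedron with [n]
   facets, as a supremum in the extended reals; it is attained whenever such
   a polyhedron exists, since there are then only finitely many
   combinatorial types. *)
Definition Delta_u (d n : nat) : \bar R :=
  ereal_sup [set y | exists (N : nat) (P : set 'rV[R]_N),
    [/\ polyhedron P, affdim P d, pointed P,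
        ([set F | facet P F] #= `I_n)%card & y = diameter P]].

Definition log2 (x : R) : R := ln x / ln 2.

(* An index vector (i_d, ..., i_4) is a list of length [d - 3] in this
   order; [idx d s q] is its entry i_q. *)
Definition idx (d : nat) (s : seq nat) (q : nat) : nat := nth 0%N s (d - q).

(* The current number of facets when the inequality is applied at
   dimension [q]. *)
Definition cur_facets (d n : nat) (s : seq nat) (q : nat) : nat :=
  (n %/ 2 ^ (\sum_(q.+1 <= p < d.+1) idx d s p))%N.

Definition leaves (d n : nat) : set (seq nat) :=
  [set s | size s = (d - 3)%N /\
    forall q, (4 <= q <= d)%N ->
      (idx d s q)%:Z <= Num.floor (log2 ((cur_facets d n s q)%:R / q%:R))].

Definition contribution (d n : nat) (s : seq nat) : \bar R :=
  let J := (\sum_(4 <= q < d.+1) idx d s q)%N in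
  ((2 ^ J)%:R%:E * Delta_u 3 (n %/ 2 ^ J))%E.

(* Only used for subsets of [leaves d n], which are finite when
   [4 <= d <= n]. *)
Definition total_contribution (d n : nat) (F : set (seq nat)) : \bar R :=
  (\sum_(s \in F) contribution d n s)%E.

(* [U d n] is an upper estimate of the total contribution of the recursion
   leaves of (d, n). *)
Definition positive_count (U : nat -> nat -> \bar R) :=
  forall d n, (4 <= d)%N -> (2 * d <= n)%N ->
    (total_contribution d n (leaves d n) <= U d n)%E.

Definition curved_path_power (G : nat -> R) (d n : nat) : R :=
  (n%:R - d%:R) `^ log2 (G d).

(* G_d = (c + o(1)) d / (ln d)^2 as d tends to infinity. *)
Definition leading_constant (c : R) (G : nat -> R) :=
  exists e : nat -> R, e @ \oo --> (0 : R) /\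
    \forall d \near \oo, G d = (c + e d) * (d%:R / ln d%:R ^+ 2).

(* d 2^floor((ln d)^2 / (2 ln 2)) *)
Definition sharp_n (d : nat) : nat :=
  (d * 2 ^ Num.truncn (ln (d%:R : R) ^+ 2 / (2 * ln 2)))%N.

End Leaves.

(* Main.v *)
Require Import Defs.
From HB Require Import structures.
From mathcomp Require Import all_boot all_order all_algebra.
From mathcomp Require Import all_classical all_reals all_analysis.
From mathcomp Require Import ring lra zify.
Import Order.TTheory GRing.Theory Num.Theory.
Import numFieldNormedType.Exports.
Local Open Scope classical_set_scope.
Local Open Scope ring_scope.

(** The family of leaves is the family of all leaves of [(d, n)], where
[n = d * 2 ^ k] and [k] is about [L ^ 2 / (2 * ln 2)], with [L = ln d].

Every leaf ends with at least four facets, and for every [m >= 4] there is a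
three-dimensional polyhedron with [m] facets and two vertices
([Delta_u3_ge1]).  So a leaf with index sum [J] contributes at least [2 ^ J],
and it suffices to bound from below the sum [W] of these powers of two
([leaf_weight]).  On the leaves that matter, few facets remain, and replacing
[Delta_u(3, _)] by [1] costs a factor [e ^ o(k)], which the [o(1)] absorbs.

Admissibility of [i_q] means [q * 2 ^ i_q <= m], with [m] the current number
of facets.  Restricting to indices [0] and [1] turns the recursion for [W]
into Pascal's, with weight two on index [1].  In the dimensions from [d] down
to about [2 ^ a = d / 2 ^ r], with [r] a large constant, any [k] indices may
be [1]; this gives the factor [2 ^ k * 'C(d - 2 ^ a, k)], which Stirling's
formula compares with [(2 * e * d / k) ^ k = (4 * e * ln 2 * d / L ^ 2) ^ k].
Below, the index sum may exceed [k]: once [q <= d / 2 ^ j] it may reach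
[k + j].  Placing one more [1] in each dyadic range of dimensions gives the
factor [2 ^ (a + ... + 3)], about [2 ^ (a ^ 2 / 2)], that is [e ^ k] up to
lower order ([leaf_weight_lower]).

The bound to be reached is [g ^ log2 (n - d)], about [g ^ k * g ^ log2 d],
where [g = 4 * ln 2 * d / L ^ 2] and [g ^ log2 d] is about [d ^ log2 d], that
is [e ^ (2 * k)].  The two factors [e ^ k] found above match it.  Hence for
every [c < 4 * ln 2] the bound with [c] in place of [4 * ln 2] is eventually
below [W] ([near_curved_path_power_le]).

Both halves of the theorem follow.  For the first, take for [G d] the smaller
of [g] and the base for which the bound equals [W].  For the second,
a positive count is at least [W], so its base is eventually at least
[c * d / L ^ 2] for every [c < 4 * ln 2]. *)

(** * Affine geometry *)

Section Dot.
Context {R : realType} {N : nat}.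
Implicit Types (u v w : 'rV[R]_N).

Lemma dotE u v : dot u v = (u *m v^T) 0 0.
Proof. by rewrite mxE; apply: eq_bigr => i _; rewrite mxE. Qed.

Lemma dotDr u v w : dot u (v + w) = dot u v + dot u w.
Proof. by rewrite !dotE linearD mulmxDr mxE. Qed.

Lemma dotZr u t v : dot u (t *: v) = t * dot u v.
Proof. by rewrite !dotE linearZ -scalemxAr mxE. Qed.

Lemma dotZl t u v : dot (t *: u) v = t * dot u v.
Proof. by rewrite !dotE -scalemxAl mxE. Qed.

Lemma dotBr u v w : dot u (v - w) = dot u v - dot u w.
Proof. by rewrite dotDr -scaleN1r dotZr mulN1r. Qed.

Lemma dot_sumr (I : finType) u (v : I -> 'rV[R]_N) :
  dot u (\sum_i v i) = \sum_i dot u (v i).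
Proof.
rewrite dotE linear_sum mulmx_sumr summxE.
by apply: eq_bigr => i _; rewrite dotE.
Qed.

Lemma dot_eq0 u : dot u u = 0 -> u = 0.
Proof.
move/eqP; rewrite psumr_eq0 => [/allP u0|i _]; last exact: sqr_ge0.
apply/rowP => i; rewrite mxE; apply/eqP.
by have := u0 i (mem_index_enum i); rewrite mulf_eq0 orbb.
Qed.

Lemma dot_row_eq0 k (A : 'M[R]_(k, N)) u :
  (forall i, dot u (row i A) = 0) <-> u *m A^T = 0.
Proof.
have E i : dot u (row i A) = (u *m A^T) 0 i.
  by rewrite mxE; apply: eq_bigr => j _; rewrite !mxE.
split=> [u0|u0 i]; last by rewrite E u0 mxE.
by apply/rowP => i; rewrite -E u0 mxE.
Qed.

Lemma dot_submx k (A : 'M[R]_(k, N)) u v :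
  u *m A^T = 0 -> (v <= A)%MS -> dot u v = 0.
Proof.
by move=> uA /submxP[D ->]; rewrite dotE trmx_mul mulmxA uA mul0mx mxE.
Qed.

(** The row spaces of two affine bases contain one another. *)
Lemma affdim_uniq (S : set 'rV[R]_N) k l : affdim S k -> affdim S l -> k = l.
Proof.
have le k' l' : affdim S k' -> affdim S l' -> (k' <= l')%N.
  move=> [x [A [/eqP rA Sx SA _]]] [y [B [/eqP rB _ _ SB]]].
  rewrite -[leqLHS]rA -[leqRHS]rB; apply/mxrankS/row_subP => i.
  have -> : row i A = (x + row i A - y) - (x - y).
    by rewrite opprB addrA subrK addrC addKr.
  by rewrite addmx_sub ?eqmx_opp ?SB.
by move=> Sk Sl; apply/eqP; rewrite eqn_leq !le.
Qed.

End Dot.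

(** * Facets of an irredundant system of inequalities *)

Section Irredundant.
Context {R : realType} {N : nat} {m : nat}.
Context (a : nat -> 'rV[R]_N) (b : nat -> R).

Definition halfspaces : set 'rV[R]_N :=
  [set x | forall i, (i < m)%N -> dot (a i) x <= b i].

Definition wall (i : nat) : set 'rV[R]_N :=
  [set x | halfspaces x /\ dot (a i) x = b i].

Lemma halfspaces_polyhedron :
  (forall i, (i < m)%N -> a i != 0) -> polyhedron halfspaces.
Proof.
move=> a0; exists [seq (a i, b i) | i <- iota 0 m]; split.
  by move=> h /mapP[i]; rewrite mem_iota => /= im ->; exact: a0.
apply/seteqP; split=> x /= Px => [h /mapP[i]|i im].
  by rewrite mem_iota => /= im -> /=; exact: Px.
by apply: (Px (a i, b i)); apply: map_f; rewrite mem_iota.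
Qed.

(** Only the inequalities that are strict at [p] limit how far one can move,
and there are finitely many of them. *)
Lemma halfspaces_step k (A : 'M[R]_(k, N)) p : halfspaces p ->
  (forall j, (j < m)%N -> dot (a j) p = b j -> a j *m A^T = 0) ->
  exists2 t : R, 0 < t & forall i, halfspaces (p + t *: row i A).
Proof.
move=> Pp aA.
have Pt (i : 'I_k) (j : 'I_m) :
    \forall t \near 0^'+, dot (a j) (p + t *: row i A) <= b j.
  have [pj|pj] := eqVneq (dot (a j) p) (b j).
    apply: nearW => t; rewrite dotDr dotZr pj.
    by move/dot_row_eq0 : (aA j (ltn_ord j) pj) => ->; rewrite mulr0 addr0.
  have {pj} pj : dot (a j) p < b j by rewrite lt_neqAle pj Pp.
  set q := dot (a j) (row i A).
  have q0 : 0 < 1 + `|q| by rewrite ltr_pwDl.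
  near=> t; rewrite dotDr dotZr -/q.
  have t0 : 0 < t by near: t; exact: nbhs_right_gt.
  have tle : t <= (b j - dot (a j) p) / (1 + `|q|).
    by near: t; apply: nbhs_right_le; rewrite divr_gt0 // subr_gt0.
  rewrite -lerBrDl; apply: (@le_trans _ _ (t * (1 + `|q|))).
    by rewrite (ler_wpM2l (ltW t0)) // (le_trans (ler_norm q)) // lerDr.
  by rewrite -ler_pdivlMr.
have : \forall t \near 0^'+, 0 < t /\
    forall (i : 'I_k) (j : 'I_m), dot (a j) (p + t *: row i A) <= b j.
  near=> t; split; first by near: t; exact: nbhs_right_gt.
  by near: t; apply: filter_forall => i; apply: filter_forall.
case/filter_ex => t [t0 Ht]; exists t => // i j jm.
exact: (Ht i (Ordinal jm)).
Unshelve. all: end_near. Qed.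

Lemma row_free_scale k (A : 'M[R]_(k, N)) (t : R) :
  t != 0 -> row_free (t *: A) = row_free A.
Proof. by move=> t0; rewrite /row_free (eqmx_scale A t0). Qed.

Context (interior_point :
  exists z, forall i, (i < m)%N -> dot (a i) z < b i).
Context (wall_point : forall i, (i < m)%N -> exists p,
  dot (a i) p = b i /\
  forall j, (j < m)%N -> j != i -> dot (a j) p < b j).

Lemma normal_neq0 i : (i < m)%N -> a i != 0.
Proof.
move=> im; apply/eqP => ai0; case: interior_point => z /(_ i im).
have d0 x : dot (a i) x = 0 by rewrite ai0 dotE mul0mx mxE.
by case: (wall_point i im) => p [+ _]; rewrite !d0 => <-; rewrite ltxx.
Qed.

Lemma wall_pointP i : (i < m)%N -> exists p, wall i p /\
  forall j, (j < m)%N -> j != i -> dot (a j) p < b j.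
Proof.
move=> im; case: (wall_point i im) => p [pi pj]; exists p; split=> //.
split=> // j jm; have [->|/(pj j jm)/ltW//] := eqVneq j i.
by rewrite pi.
Qed.

Lemma wall_inj i j : (i < m)%N -> (j < m)%N -> wall i = wall j -> i = j.
Proof.
move=> im jm ij; apply/eqP/contraT; rewrite eq_sym => ji.
have [p [wp /(_ j jm ji)]] := wall_pointP i im.
by move: wp; rewrite ij => -[_ ->]; rewrite ltxx.
Qed.

Lemma halfspaces_affdim : affdim halfspaces N.
Proof.
case: interior_point => z zP.
have [] := @halfspaces_step N 1%:M z.
- by move=> i im; exact/ltW/zP.
- by move=> j jm zj; have := zP j jm; rewrite zj ltxx.
move=> t t0 Pt; exists z, (t *: 1%:M); split.
- by rewrite row_free_scale ?gt_eqF// row_free_unit unitmx1.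
- by move=> i im; exact/ltW/zP.
- by move=> i; rewrite linearZ; exact: Pt.
- by move=> x _; rewrite (eqmx_scale _ (lt0r_neq0 t0)) submx1.
Qed.

(** Around a point where only the [i]-th inequality is tight, one can move in
every direction orthogonal to [a i]. *)
Lemma wall_affdim i : (i < m)%N -> affdim (wall i) N.-1.
Proof.
move=> im; have [p [[Pp pi] pj]] := wall_pointP i im.
pose A := row_base (kermx (a i)^T).
have aA : a i *m A^T = 0.
  apply: trmx_inj; rewrite trmx_mul trmxK trmx0; apply/sub_kermxP.
  by rewrite eq_row_base.
have rkA : \rank (kermx (a i)^T) = N.-1.
  by rewrite mxrank_ker mxrank_tr rank_rV normal_neq0 // subn1.
rewrite -rkA.
have [] := @halfspaces_step _ A p Pp.
  move=> j jm; have [->//|/(pj j jm)] := eqVneq j i.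
  by move=> + E; rewrite E ltxx.
move=> t t0 Pt; exists p, (t *: A); split=> //.
- by rewrite row_free_scale ?gt_eqF// row_base_free.
- move=> l; rewrite linearZ; split; first exact: Pt.
  by rewrite dotDr dotZr (dot_row_eq0 _ A (a i)).2 // mulr0 addr0.
- move=> x [_ xi]; rewrite (eqmx_scale _ (lt0r_neq0 t0)) eq_row_base.
  apply/sub_kermxP/trmx_inj; rewrite trmx_mul trmxK trmx0.
  by apply/rowP => l; rewrite (ord1 l) -dotE dotBr xi pi subrr mxE.
Qed.

Lemma wall_facet i : (i < m)%N -> facet halfspaces (wall i).
Proof.
move=> im; split.
  by exists (a i), (b i); split=> // x /(_ i im).
exists N.-1; split; last exact: wall_affdim.
rewrite prednK; first exact: halfspaces_affdim.
case: posnP => // N0; case/eqP: (normal_neq0 i im); apply/rowP => l.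
by have := ltn_ord l; rewrite [X in (_ < X)%N]N0.
Qed.

(** The centroid of an affine basis of a facet lies on the boundary, hence
on some wall; as every basis point satisfies the inequality of this wall, all
of them satisfy it with equality, so facet and wall span the same
hyperplane. *)
Lemma facet_wall F : facet halfspaces F ->
  exists2 i, (i < m)%N & F = wall i.
Proof.
move=> [[c [e [Pce FE]]] [k [Pk Fk]]].
have kN : k.+1 = N by exact: affdim_uniq Pk halfspaces_affdim.
case: (Fk) => x [A [rA Fx FA Fsub]].
pose pt (o : option 'I_k) := if o is Some i then x + row i A else x.
have Fpt o : F (pt o) by case: o => [i|] /=.
have Ppt o : halfspaces (pt o) by have := Fpt o; rewrite FE => -[].
have cpt o : dot c (pt o) = e by have := Fpt o; rewrite FE => -[].
have [[i im ipt]|noi] := pselect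
    (exists2 i, (i < m)%N & forall o, dot (a i) (pt o) = b i).
  exists i => //.
  have diff u v : (forall o, dot u (pt o) = v) -> u *m A^T = 0.
    move=> uv; apply/dot_row_eq0 => j; have := uv (Some j).
    by rewrite /= dotDr (uv None) => /(canRL (addKr _)); rewrite addNr.
  have aA := diff _ _ ipt; have cA := diff _ _ cpt.
  have rkk : \rank (kermx A^T) = 1%N.
    by rewrite mxrank_ker mxrank_tr (eqP rA) -kN subSnn.
  have /sub_rVP[l cl] : (c <= a i)%MS.
    have ak : (a i <= kermx A^T)%MS by apply/sub_kermxP.
    apply: submx_trans (_ : kermx A^T <= a i)%MS; first exact/sub_kermxP.
    by rewrite -(mxrank_leqif_sup ak) rkk rank_rV normal_neq0.
  apply/seteqP; split=> y.
    move=> Fy; split; first by move: Fy; rewrite FE => -[].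
    rewrite -(ipt None) /=; apply/eqP; rewrite -subr_eq0 -dotBr.
    by rewrite (dot_submx _ _ _ _ aA) ?Fsub.
  move=> [Py yi]; rewrite FE; split=> //.
  by rewrite -(cpt None) cl !dotZl yi (ipt None).
(* Otherwise the centroid is interior, so [c] vanishes and [F] is the whole
   polyhedron, of the wrong dimension. *)
pose y := k.+1%:R^-1 *: \sum_o pt o.
have dy u : dot u y = k.+1%:R^-1 * \sum_o dot u (pt o).
  by rewrite dotZr dot_sumr.
have sumc (u : R) : \sum_(o : option 'I_k) u = k.+1%:R * u.
  by rewrite sumr_const card_option card_ord mulr_natl.
have k0 : (0 : R) < k.+1%:R by rewrite ltr0n.
have yP j : (j < m)%N -> dot (a j) y < b j.
  move=> jm; rewrite dy mulrC ltr_pdivrMr // mulrC -sumc.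
  have [w /eqP wj] : exists w, dot (a j) (pt w) <> b j.
    by apply: contrapT => /forallNP no; apply: noi; exists j => // w;
       apply: contrapT; exact: no.
  rewrite [ltLHS](bigD1 w) //= [ltRHS](bigD1 w) //= ltr_leD //.
    by rewrite lt_neqAle wj Ppt.
  by apply: ler_sum => w' _; exact: Ppt.
have Py : halfspaces y by move=> j /yP/ltW.
have cy : dot c y = e.
  by rewrite dy (eq_bigr (fun=> e)) // sumc mulKf ?gt_eqF.
have c0 : c = 0.
  have [|t t0 /(_ 0)] := @halfspaces_step 1 c y Py.
    by move=> j /yP + E; rewrite E ltxx.
  rewrite row_id => /Pce; rewrite dotDr dotZr cy gerDl pmulr_rle0 // => cc.
  apply: dot_eq0; apply/eqP; rewrite eq_le cc sumr_ge0 // => i _.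
  exact: sqr_ge0.
have FP : F = halfspaces.
  rewrite FE; apply/seteqP; split=> u /=; first by case.
  by split=> //; rewrite -cy c0 !dotE !mul0mx.
rewrite FP in Fk.
have /eqP := affdim_uniq _ _ _ Pk Fk.
by rewrite -[X in _ == X]addn0 -addn1 eqn_add2l.
Qed.

Lemma card_facets : ([set F | facet halfspaces F] #= `I_m)%card.
Proof.
have -> : [set F | facet halfspaces F] = wall @` `I_m.
  apply/seteqP; split=> F /=.
    by move/facet_wall => [i im ->]; exists i.
  by move=> [i im <-]; exact: wall_facet.
apply: inj_card_eq => i j; rewrite !inE => im jm; exact: wall_inj.
Qed.

End Irredundant.

(** * Polyhedra with any number of facets and two vertices *)

Section Tangents.
Context (R : realType).

Definition vec3 (x y z : R) : 'rV[R]_3 := \row_i nth 0 [:: x; y; z] i.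

Lemma dot_vec3 x y z u v w :
  dot (vec3 x y z) (vec3 u v w) = x * u + y * v + z * w.
Proof. by rewrite /dot !big_ord_recl big_ord0 !mxE /= addr0 !addrA. Qed.

Lemma vec3_eta (x : 'rV[R]_3) :
  x = vec3 (x 0 0) (x 0 1) (x 0 2).
Proof.
apply/rowP => -[[|[|[|//]]] i3]; rewrite mxE /=; congr (x _ _);
  exact/val_inj.
Qed.

(** The half-space [z >= 0] and the half-spaces above the tangents
[y = 2 * i * x - i ^ 2] of the parabola [y = x ^ 2].  No tangent is redundant,
being the only one through its point of contact, so the first [m] of these
half-spaces intersect in an unbounded polyhedron with [m] facets. *)
Definition tangent_normal (i : nat) : 'rV[R]_3 :=
  if i is j.+1 then vec3 (2 * j%:R) (-1) 0 else vec3 0 0 (-1).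

Definition tangent_bound (i : nat) : R := if i is j.+1 then j%:R ^+ 2 else 0.

Local Notation P m := (@halfspaces R 3 m tangent_normal tangent_bound).

Lemma tangent_interior m :
  exists z, forall i, (i < m)%N -> dot (tangent_normal i) z < tangent_bound i.
Proof.
exists (vec3 0 1 1) => -[|i] _ /=; rewrite dot_vec3; first by lra.
by have := sqr_ge0 (i%:R : R); lra.
Qed.

Lemma tangent_wall m i : (i < m)%N -> exists p,
  dot (tangent_normal i) p = tangent_bound i /\
  forall j, (j < m)%N -> j != i -> dot (tangent_normal j) p < tangent_bound j.
Proof.
case: i => [|i] _.
  exists (vec3 0 1 0); split; first by rewrite /= dot_vec3; lra.
  move=> [|j] _ //= _; rewrite dot_vec3.
  by have := sqr_ge0 (j%:R : R); lra.
exists (vec3 i%:R (i%:R ^+ 2) 1); split.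
  by rewrite dot_vec3 /=; ring.
move=> [|j] _ /=; rewrite dot_vec3; first by move=> _; lra.
rewrite eqSS => ji.
have : 0 < (j%:R - i%:R : R) ^+ 2.
  by rewrite lt_neqAle sqr_ge0 andbT eq_sym sqrf_eq0 subr_eq0 eqr_nat.
by rewrite sqrrB; lra.
Qed.

(** Consecutive tangents meet at abscissa [i + 1 / 2].  The supporting
functional is the sum of the two tangent inequalities and of [z >= 0]. *)
Lemma tangent_vertex m i : (i.+2 < m)%N ->
  vertex (P m) (vec3 (i%:R + 2^-1) (i%:R ^+ 2 + i%:R) 0).
Proof.
move=> im; exists (vec3 (4 * i%:R + 2) (-2) (-1)).
exists (i%:R ^+ 2 + (i%:R + 1) ^+ 2).
have cons x y z : P m (vec3 x y z) ->
    [/\ - z <= 0, 2 * i%:R * x - y <= i%:R ^+ 2 &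
      2 * (i%:R + 1) * x - y <= (i%:R + 1) ^+ 2].
  move=> H; split.
  - have /H : (0 < m)%N by lia.
    by rewrite /= dot_vec3; lra.
  - have /H : (i.+1 < m)%N by lia.
    by rewrite /= dot_vec3; lra.
  - by have /H := im; rewrite /= dot_vec3 natr1; lra.
split.
  move=> x; rewrite (vec3_eta x) => /cons[z0 i0 i1]; rewrite dot_vec3.
  lra.
apply/seteqP; split=> x /=.
  move=> ->; split; last by rewrite dot_vec3; field.
  move=> [|j] _ /=; rewrite dot_vec3; first by lra.
  (* No integer lies strictly between [i] and [i + 1]. *)
  have : 0 <= (j%:R - i%:R : R) * (j%:R - i%:R - 1).
    have [ji|ij] := leqP j i.
      have : (j%:R : R) <= i%:R by rewrite ler_nat.
      by move=> ?; rewrite mulr_le0//; lra.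
    have : (i%:R + 1 : R) <= j%:R by rewrite natr1 ler_nat.
    by move=> ?; rewrite mulr_ge0//; lra.
  lra.
rewrite (vec3_eta x); set x0 := x 0 0; set x1 := x 0 1; set x2 := x 0 2.
rewrite dot_vec3 => -[/cons[z0 i0 i1] E].
have Ez : x2 = 0 by lra.
have E0 : 2 * i%:R * x0 - x1 = i%:R ^+ 2 by lra.
have E1 : 2 * (i%:R + 1) * x0 - x1 = (i%:R + 1) ^+ 2 by lra.
have Ex : x0 = i%:R + 2^-1 by lra.
by rewrite Ez -Ex; congr vec3; move: E0; rewrite Ex; lra.
Qed.

End Tangents.

Lemma graph_dist_ge1 (R : realType) N (P : set 'rV[R]_N) u v :
  u <> v -> (1 <= graph_dist P u v)%E.
Proof.
move=> uv; apply: le_ereal_inf_tmp => _ [k [p [p0 pk _]] <-].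
rewrite lee_fin ler1n lt0n; apply/eqP => k0.
by apply: uv; rewrite -p0 -pk k0.
Qed.

Lemma Delta_u3_ge1 (R : realType) m : (4 <= m)%N -> (1 <= Delta_u R 3 m)%E.
Proof.
move=> m4.
pose P := @halfspaces R 3 m (tangent_normal R) (tangent_bound R).
have v0 := tangent_vertex R m 0 (ltnW m4).
have v1 := tangent_vertex R m 1 m4.
have tn i : (i < m)%N -> tangent_normal R i != 0.
  by apply: normal_neq0; [exact: tangent_interior|exact: tangent_wall].
apply: (@le_trans _ _ (diameter P)); last first.
  apply: ereal_sup_ubound; exists 3, P; split => //.
  - exact: halfspaces_polyhedron.
  - exact/halfspaces_affdim/tangent_interior.
  - by eexists; exact: v0.
  - by apply: card_facets; [exact: tangent_interior|exact: tangent_wall].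
apply: le_trans (graph_dist_ge1 _ _ P _ _ _) _; last first.
  apply: ereal_sup_ubound; do 2 eexists.
  by split; [exact: v0|exact: v1|reflexivity].
move=> /rowP/(_ 0); rewrite !mxE /=; lra.
Qed.

(** * Counting leaves *)

(** The leaves of [(e + 3, n)], listed by the recursion on the dimension.  The
admissibility of an index is stated without logarithms. *)
Fixpoint leaf_seq (e n : nat) : seq (seq nat) :=
  if e is e'.+1 then
    [seq i :: s | i <- [seq i <- iota 0 n.+1 | (e + 3) * 2 ^ i <= n]%N,
                  s <- leaf_seq e' (n %/ 2 ^ i)]
  else [:: [::]].

Lemma mem_leaf_seqS e n s : reflect
  (exists i s', [/\ s = i :: s', ((e.+1 + 3) * 2 ^ i <= n)%N
                  & s' \in leaf_seq e (n %/ 2 ^ i)])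
  (s \in leaf_seq e.+1 n).
Proof.
apply: (iffP allpairsPdep) => [[i [s' [+ s'e ->]]]|[i [s' [-> ile s'e]]]].
  by rewrite mem_filter => /andP[ie _]; exists i, s'.
exists i, s'; split=> //; rewrite mem_filter ile mem_iota /= add0n ltnS.
by rewrite (leq_trans _ ile) // (leq_trans (ltnW (ltn_expl i (ltnSn 1)))) //
  leq_pmull // addnS.
Qed.

Lemma leaf_seq_uniq e n : uniq (leaf_seq e n).
Proof.
elim: e n => [//|e IH] n.
apply: allpairs_uniq_dep => [|i _|[i s] [j t] _ _ /= [-> ->]//].
- exact/filter_uniq/iota_uniq.
- exact: IH.
Qed.

(** What the leaves of [(e + 3, n)] would contribute in total if every
[Delta_u(3, _)] were [1]. *)
Definition leaf_weight (e n : nat) : nat :=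
  (\sum_(s <- leaf_seq e n) 2 ^ sumn s)%N.

Lemma leaf_weight0 n : leaf_weight 0 n = 1%N.
Proof. by rewrite /leaf_weight big_seq1. Qed.

Lemma leaf_weightS e n : leaf_weight e.+1 n =
  (\sum_(0 <= i < n.+1 | (e.+1 + 3) * 2 ^ i <= n)
    2 ^ i * leaf_weight e (n %/ 2 ^ i))%N.
Proof.
rewrite /leaf_weight big_allpairs_dep big_filter /index_iota subn0.
apply: eq_bigr => i _; rewrite big_distrr; apply: eq_bigr => s _ /=.
by rewrite expnD.
Qed.

Lemma leaf_weight_ge0 e n : (e + 4 <= n)%N ->
  (leaf_weight e n <= leaf_weight e.+1 n)%N.
Proof.
move=> en; rewrite leaf_weightS big_mkcond big_nat_recl //= expn0 divn1 muln1.
by rewrite mul1n addSnnS en leq_addr.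
Qed.

(** The branches with [i_q = 0] and [i_q = 1] alone yield the recursion of
Pascal's triangle, with weight two on the second step. *)
Lemma leaf_weight_ge01 e n : ((e + 4) * 2 <= n)%N ->
  (leaf_weight e n + 2 * leaf_weight e (n %/ 2) <= leaf_weight e.+1 n)%N.
Proof.
move=> en; rewrite leaf_weightS big_mkcond big_nat_recl //= expn0 divn1 muln1.
rewrite mul1n addSnnS (_ : (e + 4 <= n)%N); last by lia.
case: n en => [|n] en; first by lia.
by rewrite leq_add2l big_nat_recl //= expn1 en leq_addr.
Qed.

Lemma leaf_weight_gt0 e n : (e + 3 <= n)%N -> (0 < leaf_weight e n)%N.
Proof.
elim: e n => [|e IH] n en; first by rewrite leaf_weight0.
by apply: leq_trans (leaf_weight_ge0 _ _ _); [apply: IH; lia|lia].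
Qed.

(** Choose which [j] of the top [s] indices are [1].  The hypothesis says that
all these choices are admissible: the largest dimension is [e + s + 3], and
the index sum never exceeds [t + j]. *)
Lemma leaf_weight_binomial n s e t j : ((e + s + 3) * 2 ^ (t + j) <= n)%N ->
  ('C(s, j) * 2 ^ j * leaf_weight e (n %/ 2 ^ (t + j)) <=
   leaf_weight (e + s) (n %/ 2 ^ t))%N.
Proof.
elim: s t j => [|s IH] t [|j] H.
- by rewrite bin0 !mul1n !addn0.
- by rewrite bin0n !mul0n.
- rewrite bin0 !mul1n addn0 addnS; rewrite addn0 in H.
  have := IH t 0%N; rewrite bin0 !mul1n addn0 => /(_ _)/leq_trans-> //.
    by apply: leq_trans H; rewrite leq_mul2r; apply/orP; right; lia.
  apply: leaf_weight_ge0; rewrite leq_divRL ?expn_gt0 //.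
  by apply: leq_trans H; rewrite leq_mul2r; apply/orP; right; lia.
rewrite binS !mulnDl [(e + s.+1)%N]addnS.
apply: leq_trans (leaf_weight_ge01 _ _ _); last first.
  rewrite leq_divRL ?expn_gt0 // -mulnA -expnS; apply: leq_trans H.
  by apply: leq_mul; [lia | rewrite leq_exp2l //; lia].
apply: leq_add.
  apply: IH; apply: leq_trans H; apply: leq_mul => //; lia.
rewrite -divnMA -expnSr expnS [('C(s, j) * _)%N]mulnCA -!mulnA leq_mul2l /=.
rewrite mulnA -addSnnS; apply: IH; rewrite addSnnS.
by apply: leq_trans H; apply: leq_mul => //; lia.
Qed.

(** One index [1] in each range of dimensions from [2 ^ b] to [2 ^ b.+1], which
has [2 ^ b] possible places and weight two.  The index sum may increase by one
each time the dimension is halved, so admissibility is preserved.  The product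
of the factors [2 ^ b.+1] is [2 ^ (a + ... + 3)]; the [8] supplies the missing
[2 + 1] in the exponent. *)
Lemma leaf_weight_halving n a t : (2 <= a)%N -> (2 ^ (a + t).+1 <= n)%N ->
  (2 ^ 'C(a.+1, 2) <= 8 * leaf_weight (2 ^ a - 3) (n %/ 2 ^ t))%N.
Proof.
elim: a t => [//|[//|[|a]] IH] t _ H.
  rewrite leq_pmulr //; apply: leaf_weight_gt0.
  by rewrite leq_divRL ?expn_gt0 // (leq_trans _ H) // !expnS; lia.
set A := a.+2 in IH H *.
have A4 : (4 <= 2 ^ A)%N by rewrite !expnS; have := expn_gt0 2 a; lia.
have := IH t.+1 isT; rewrite addnS -[(A + t).+1]addSn => /(_ H) IHt.
have := leaf_weight_binomial n (2 ^ A) (2 ^ A - 3) t 1.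
rewrite bin1 addn1 (_ : (_ + _ + 3 = 2 ^ A.+1)%N); last by rewrite expnS; lia.
rewrite (_ : (_ + _ = 2 ^ A.+1 - 3)%N); last by rewrite expnS; lia.
rewrite -expnD addnS -addSn => /(_ H) Hb.
rewrite binS bin1 expnD; apply: leq_trans (leq_mul IHt (leqnn _)) _.
by rewrite -mulnA leq_mul2l /= mulnC [X in (X * _)%N]expnSr.
Qed.

Lemma leaf_weight_lower d k a : (2 <= a)%N -> (2 ^ a.+1 <= d)%N ->
  ('C(d - 2 ^ a, k) * 2 ^ k * 2 ^ 'C(a.+1, 2) <=
   8 * leaf_weight (d - 3) (d * 2 ^ k))%N.
Proof.
move=> a2 ad.
have A4 : (4 <= 2 ^ a)%N by rewrite -[4%N]/(2 ^ 2)%N leq_exp2l.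
rewrite expnS in ad.
have := leaf_weight_binomial (d * 2 ^ k) (d - 2 ^ a) (2 ^ a - 3) 0 k.
rewrite add0n expn0 divn1 (_ : (_ + _ + 3 = d)%N); last by lia.
rewrite (_ : (_ + _ = d - 3)%N); last by lia.
move=> /(_ (leqnn _)) Hb.
apply: leq_trans (leq_mul (leqnn 8) Hb).
rewrite mulnCA leq_mul2l; apply/orP; right.
apply: leaf_weight_halving => //; rewrite -addSn expnD leq_mul2r expnS ad.
by rewrite orbT.
Qed.

(** * The total contribution of all leaves *)

Section LeavesAsSequence.
Context (R : realType).

Lemma leq_floor_log2 m q i : (0 < m)%N -> (0 < q)%N ->
  (i%:Z <= Num.floor (log2 (m%:R / q%:R : R))) = (q * 2 ^ i <= m)%N.
Proof.
move=> m0 q0; have l2 : 0 < ln (2 : R) by rewrite ln_gt0 // ltr1n.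
have q0' : (0 : R) < q%:R by rewrite ltr0n.
rewrite real_floor_ge_int ?num_real // -[i%:~R]/(i%:R) /log2 ler_pdivlMr //.
rewrite [i%:R * _]mulr_natl -lnXn //.
rewrite ler_ln ?posrE ?exprn_gt0 ?divr_gt0 ?ltr0n //.
by rewrite ler_pdivlMr // mulrC -natrX -natrM ler_nat.
Qed.

Lemma idx_cons d i s q : (q <= d)%N -> idx d.+1 (i :: s) q = idx d s q.
Proof. by move=> qd; rewrite /idx subSn. Qed.

Lemma idx_head d i s : idx d (i :: s) d = i.
Proof. by rewrite /idx subnn. Qed.

Lemma sum_idx_cons d i s q : (q <= d)%N ->
  (\sum_(q.+1 <= p < d.+2) idx d.+1 (i :: s) p =
   i + \sum_(q.+1 <= p < d.+1) idx d s p)%N.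
Proof.
move=> qd; rewrite big_nat_recr //= idx_head addnC; congr addn.
by apply: eq_big_nat => p /andP[_ pd]; rewrite idx_cons.
Qed.

Lemma cur_facets_cons d n i s q : (q <= d)%N ->
  cur_facets d.+1 n (i :: s) q = cur_facets d (n %/ 2 ^ i) s q.
Proof. by move=> qd; rewrite /cur_facets sum_idx_cons // expnD divnMA. Qed.

Lemma leaves_cons d n i s : (3 <= d)%N -> (0 < n)%N ->
  leaves R d.+1 n (i :: s) <->
  (d.+1 * 2 ^ i <= n)%N /\ leaves R d (n %/ 2 ^ i) s.
Proof.
move=> d3 n0.
have cur : cur_facets d.+1 n (i :: s) d.+1 = n.
  by rewrite /cur_facets big_geq // expn0 divn1.
split=> [[szs H]|[iE [szs H]]].
  split.
    have := H d.+1; rewrite idx_head cur leq_floor_log2 // => -> //.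
    by rewrite leqnn andbT.
  split; first by move: szs => /=; rewrite subSn // => -[].
  move=> q /andP[q4 qd]; rewrite -cur_facets_cons // -(idx_cons d i) //.
  by apply: H; rewrite q4 ltnW.
split=> [|q /andP[q4]]; first by rewrite /= szs subSn.
rewrite leq_eqVlt => /predU1P[->|qd].
  by rewrite idx_head cur leq_floor_log2.
by rewrite idx_cons // cur_facets_cons // H // q4.
Qed.

Lemma leavesE e n : (e + 3 <= n)%N ->
  leaves R (e + 3) n = [set` leaf_seq e n].
Proof.
elim: e n => [|e IH] n en; apply/seteqP; split=> s /=.
- by move=> [/eqP]; rewrite size_eq0 => /eqP ->.
- rewrite inE => /eqP ->; split=> // q; lia.
- case: s => [[]|i s]; first by rewrite addSn subSn // leq_addl.
  rewrite addSn leaves_cons ?leq_addl //; last by lia.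
  move=> [iE Hs]; apply/mem_leaf_seqS; exists i, s; split=> //.
  rewrite IH // in Hs.
  by rewrite leq_divRL ?expn_gt0 // (leq_trans _ iE) // leq_mul2r leqnSn orbT.
move=> /mem_leaf_seqS [i [s' [-> iE Hs]]].
rewrite addSn leaves_cons ?leq_addl //; last by lia.
split=> //; rewrite IH //.
by rewrite leq_divRL ?expn_gt0 // (leq_trans _ iE) // leq_mul2r leqnSn orbT.
Qed.

Lemma sum_idx d s : (3 <= d)%N -> size s = (d - 3)%N ->
  (\sum_(4 <= q < d.+1) idx d s q = sumn s)%N.
Proof.
move=> d3 szs; have -> : d = (size s + 3)%N by lia.
elim: s {d d3 szs} => [|i s IH]; first by rewrite big_geq.
by rewrite /= addSn sum_idx_cons ?leq_addl // IH.
Qed.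

(** The last index [i_4] is chosen with [4 * 2 ^ i_4 <= m]. *)
Lemma leaf_facets e n s : (e + 4 <= n)%N -> s \in leaf_seq e n ->
  (4 <= n %/ 2 ^ sumn s)%N.
Proof.
elim: e n s => [|e IH] n s en.
  by rewrite inE => /eqP ->; rewrite divn1.
move=> /mem_leaf_seqS[i [s' [-> iE Hs]]] /=.
rewrite expnD divnMA; apply: IH Hs.
rewrite leq_divRL ?expn_gt0 //; apply: leq_trans iE.
by rewrite leq_mul2r; apply/orP; right; lia.
Qed.

End LeavesAsSequence.

Lemma total_contribution_ge (R : realType) d n : (4 <= d)%N -> (d < n)%N ->
  ((leaf_weight (d - 3) n)%:R%:E <= total_contribution R d n (leaves R d n))%E.
Proof.
move=> d4 dn; have dE : d = (d - 3 + 3)%N by lia.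
rewrite /total_contribution [in leaves R d n]dE leavesE; last by lia.
rewrite -fsbig_seq ?leaf_seq_uniq // /leaf_weight natr_sum -sumEFin.
rewrite big_seq [leRHS]big_seq; apply: lee_sum => s sl.
have szs : size s = (d - 3)%N.
  have : [set` leaf_seq (d - 3) n] s by [].
  rewrite -(leavesE R); last by lia.
  by case; rewrite addnK.
rewrite /contribution sum_idx //; last by lia.
rewrite -[leLHS]mule1 lee_pmul2l ?lte_fin ?ltr0n ?expn_gt0 //.
apply: Delta_u3_ge1; apply: leaf_facets sl; lia.
Qed.

(** * Asymptotics *)

Section Asymptotics.
Context (R : realType).
Implicit Types (c x : R).

Lemma ln2_gt0 : 0 < ln (2 : R).
Proof. by rewrite ln_gt0 // ltr1n. Qed.

(** The upper half of Stirling's formula, up to a factor linear in [k].  The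
induction step is [1 / (k + 2) <= - ln (1 - 1 / (k + 2))]. *)
Lemma ln_fact_le k : ln (k`!%:R : R) <= k.+1%:R * ln k.+1%:R - k%:R.
Proof.
elim: k => [|k IH]; first by rewrite ln1 mulr0 subr0.
rewrite factS natrM lnM ?posrE ?ltr0n ?fact_gt0 //.
have k1 : (0 : R) < k.+1%:R by rewrite ltr0n.
have k2 : (0 : R) < k.+2%:R by rewrite ltr0n.
have : ln (1 - k.+2%:R^-1 : R) <= - k.+2%:R^-1.
  by apply: le_ln1Dx; rewrite ltrN2 invf_lt1 // ltr1n.
have -> : 1 - k.+2%:R^-1 = k.+1%:R / k.+2%:R :> R.
  by rewrite -[in RHS](addrK 1 k.+1%:R) natr1 mulrBl divff ?gt_eqF // mul1r.
rewrite ln_div ?posrE // -(ler_pM2l k2) mulrN divff ?gt_eqF // mulrBr.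
have k2E : k.+2%:R = k.+1%:R + 1 :> R by rewrite natr1.
have k1E : k.+1%:R = k%:R + 1 :> R by rewrite natr1.
move: (ln k.+1%:R) (ln k.+2%:R) IH => u v; rewrite k2E k1E; lra.
Qed.

Lemma expn_le_binomial N k : ((N - k) ^ k <= 'C(N, k) * k`!)%N.
Proof.
rewrite bin_ffact ffact_prod -[X in (_ ^ X)%N](card_ord k) -prod_nat_const.
by apply: leq_prod => i _; apply/leq_sub2l/ltnW.
Qed.

Lemma ln_leaf_weight_ge d k a :
  (2 <= a)%N -> (2 ^ a.+1 <= d)%N -> (2 ^ a + k < d)%N ->
  k%:R * ln (d - 2 ^ a - k)%:R - (k.+1%:R * ln k.+1%:R - k%:R)
    + k%:R * ln 2 + a%:R ^+ 2 / 2 * ln 2 - 3 * ln 2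
  <= ln ((leaf_weight (d - 3) (d * 2 ^ k))%:R : R).
Proof.
move=> a2 ad akd.
have W0 : (0 < leaf_weight (d - 3) (d * 2 ^ k))%N.
  apply: leaf_weight_gt0; rewrite subnK ?leq_pmulr ?expn_gt0 //.
  by apply: leq_trans ad; apply: (@leq_trans (2 ^ 3)) => //; rewrite leq_exp2l.
have := leaf_weight_lower _ k _ a2 ad; set W := leaf_weight _ _ in W0 *.
rewrite -(leq_pmul2l (fact_gt0 k)) !mulnA [(k`! * _)%N]mulnC.
move/(leq_trans (leq_mul (leq_mul (expn_le_binomial _ k) (leqnn _)) (leqnn _))).
have N0 : (0 < d - 2 ^ a - k)%N by lia.
set N := (d - 2 ^ a - k)%N in N0 *.
rewrite -(ler_nat R) -[8%N]/(2 ^ 3)%N.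
rewrite -ler_ln ?posrE ?ltr0n ?muln_gt0 ?expn_gt0 ?fact_gt0 ?N0 ?W0 //.
rewrite !natrM !natrX !lnM ?posrE ?mulr_gt0 ?exprn_gt0 ?ltr0n ?fact_gt0 //.
rewrite !lnXn ?ltr0n // -[ln N%:R *+ _]mulr_natl -![ln 2 *+ _]mulr_natl => H.
have := ln_fact_le k.
(* [a ^ 2 <= (a + 1) * a = 2 * 'C(a.+1, 2)]. *)
have : a%:R ^+ 2 / 2 * ln 2 <= 'C(a.+1, 2)%:R * ln (2 : R).
  rewrite (ler_pM2r ln2_gt0) ler_pdivrMr // -natrX -natrM ler_nat mulnC.
  by rewrite -mul_bin_diag bin1 /= mulSn leq_addl.
lra.
Qed.

(** The comparison of exponents that remains once each factor is bounded.  Here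
[t] is [ln 2], [h] is [ln (2 * ln 2)], [u] is [log2 d], [M] is [ln (ln d)],
[A] is [ln (d - 2 ^ a - k)] and [B] is [ln (k + 1)]; the constant [c] is
[expR (t + h - eta)], so [eta] measures how far it is below [4 * ln 2].  The
products [k * u] and [k * M] cancel.  What is left on the right is about
[k + t * u ^ 2 / 2], from Stirling's formula and from [a], and on the left
[t * u ^ 2]; as [k] is about [t * u ^ 2 / 2], these cancel as well, and a
surplus [k * eta / 2] outweighs the terms linear in [u]. *)
Lemma exponent_compare (t h eta M u k a r A B : R) :
  0 < t -> 0 < eta -> 0 <= M -> 1 <= u ->
  t * u ^+ 2 / 2 - 1 <= k -> 0 <= k -> 0 <= u - r <= a ->
  t * u - eta / 4 <= A -> B <= 2 * M - h + eta / 4 ->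
  u * (t * r + (t + h - eta)) + 1 + eta / 2 + 3 * t + eta / 4 - h
    <= t * eta / 4 * u ^+ 2 ->
  (t * u - 2 * M + (t + h - eta)) * (u + k) <=
  k * A - ((k + 1) * B - k) + k * t + a ^+ 2 / 2 * t - 3 * t.
Proof.
move=> t0 eta0 M0 u1 kge k0 /andP[ur ra] HA HB Hu.
have PA : k * (t * u - eta / 4) <= k * A by rewrite ler_wpM2l.
have PB : (k + 1) * B <= (k + 1) * (2 * M - h + eta / 4).
  by rewrite ler_wpM2l // addr_ge0.
have Pa : (u - r) ^+ 2 * t <= a ^+ 2 * t.
  by rewrite ler_wpM2r ?(ltW t0) // ler_sqr // nnegrE (le_trans ur).
have Pr : 0 <= r ^+ 2 * t by rewrite mulr_ge0 ?sqr_ge0 // ltW.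
have Pk : (t * u ^+ 2 / 2 - 1) * (1 + eta / 2) <= k * (1 + eta / 2).
  by rewrite ler_wpM2r //; lra.
have PM : 0 <= M * (u - 1) by rewrite mulr_ge0 //; lra.
nra.
Qed.

Lemma near_ln_ge x : \forall d \near \oo, x <= ln (d%:R : R).
Proof.
near=> d; have d0 : (0 : R) < d%:R.
  by apply: lt_le_trans (expR_gt0 x) _; near: d; exact: nbhs_infty_ger.
rewrite -[x]expRK ler_ln ?posrE ?expR_gt0 //.
by near: d; exact: nbhs_infty_ger.
Unshelve. all: end_near. Qed.

Lemma near_lnln_ge x : \forall d \near \oo, x <= ln (ln (d%:R : R)).
Proof.
near=> d; have xd : expR x <= ln (d%:R : R) by near: d; exact: near_ln_ge.
rewrite -[x]expRK ler_ln ?posrE ?expR_gt0 //.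
exact: lt_le_trans (expR_gt0 x) xd.
Unshelve. all: end_near. Qed.

(** This is [ln y <= y] at [y = x / 4].  At [x = ln d] it gives
[(ln d) ^ 4 <= 4 ^ 4 * d], so that the index sum, of order [(ln d) ^ 2], is
negligible against [d], and [c * d / (ln d) ^ 2] is eventually at least [1]. *)
Lemma ln_ge_lnln x : 0 < x -> 4 * ln x - 4 * ln 4 <= x.
Proof.
move=> x0; have := ln_sublinear (divr_gt0 x0 (ltr0n R 4)).
by rewrite ln_div ?posrE //; lra.
Qed.

Lemma powR_log2_le_ln (X W g : R) : 1 < X -> 0 < W ->
  (X `^ log2 g <= W) = (log2 g * ln X <= ln W).
Proof.
move=> X1 W0; have X0 : 0 < X by apply: lt_trans X1.
by rewrite /powR gt_eqF // -[leRHS]lnK ?posrE // ler_expR.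
Qed.

(** The right-hand side is the base for which the power equals [W]. *)
Lemma powR_log2_leE (X W g : R) : 1 < X -> 0 < W -> 0 < g ->
  (X `^ log2 g <= W) = (g <= expR (ln 2 * (ln W / ln X))).
Proof.
move=> X1 W0 g0; have X0 : 0 < X by apply: lt_trans X1.
have l2 := ln2_gt0.
rewrite powR_log2_le_ln // -[in RHS](lnK (x := g)) ?posrE // ler_expR.
rewrite /log2 mulrAC ler_pdivrMr // -ler_pdivlMr ?ln_gt0 //.
by rewrite mulrAC mulrC mulrA.
Qed.

Lemma near_sharp_n : \forall d \near \oo,
  [/\ (4 <= d)%N, (2 * d <= sharp_n R d)%N & 0 < ln (d%:R : R)].
Proof.
have l2 := ln2_gt0; near=> d.
have L1 : Num.max 1 (2 * ln 2) <= ln (d%:R : R) by near: d; exact: near_ln_ge.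
move: L1; rewrite ge_max => /andP[L1 L2].
split; [by near: d; exact: nbhs_infty_ge| |by apply: lt_le_trans L1].
rewrite mulnC /sharp_n leq_mul2l; apply/orP; right.
rewrite -[leqLHS]expn1 leq_exp2l // -(ler_nat R).
have : (1 : R) <= ln d%:R ^+ 2 / (2 * ln 2).
  rewrite ler_pdivlMr ?mulr_gt0 // mul1r expr2.
  by apply: le_trans L2 _; rewrite ler_peMl // (le_trans _ L1).
move=> H; have := truncn_itv (le_trans ler01 H) => /andP[_ /(le_lt_trans H)].
by rewrite ltr1n ltnS ler1n.
Unshelve. all: end_near. Qed.

(** For [c] strictly below [4 * ln 2] there is room for constant factors: [eta]
is the slack, the fraction [b] of [d] lost to [2 ^ a] and again to [k] costs a
factor [expR (- (eta / 4))] per chosen index, and Stirling's formula with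
[k + 1] in place of [L ^ 2 / (2 * ln 2)] costs as much. *)
Lemma near_curved_path_power_le c : 0 < c < 4 * ln 2 ->
  \forall d \near \oo,
    ((sharp_n R d)%:R - d%:R) `^ log2 (c * (d%:R / ln d%:R ^+ 2))
    <= (leaf_weight (d - 3) (sharp_n R d))%:R.
Proof.
move=> /andP[c0 c4].
pose t : R := ln 2; pose h : R := ln (2 * t).
pose eta : R := t + h - ln c.
have t0 : 0 < t by exact: ln2_gt0.
have eta0 : 0 < eta.
  rewrite subr_gt0 /t /h -lnM ?posrE ?mulr_gt0 // mulrA -natrM.
  by rewrite ltr_ln ?posrE ?mulr_gt0.
have [q [qE q0 q1]] : exists q : R, [/\ q = expR (- (eta / 4)), 0 < q & q < 1].
  exists (expR (- (eta / 4))).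
  by rewrite expR_gt0 expR_lt1 oppr_lt0 divr_gt0.
have [b bE b0] : exists2 b : R, b = (1 - q) / 2 & 0 < b.
  by exists ((1 - q) / 2); rewrite // divr_gt0 // subr_gt0.
have [r r0 rb] : exists2 r, (0 < r)%N & b^-1 <= 2 ^+ r.
  exists (Num.truncn b^-1).+1 => //.
  apply: (@le_trans _ _ (Num.truncn b^-1).+1%:R).
    have := truncn_itv (ltW (_ : 0 < b^-1)).
    by rewrite invr_gt0 => /(_ b0)/andP[_ /ltW].
  by rewrite -natrX ler_nat ltnW // ltn_expl.
pose C1 := t * r.+1%:R + (t + h - eta).
pose C2 := 1 + eta / 2 + 3 * t + eta / 4 - h.
near=> d.
have [d4 nd L0] : [/\ (4 <= d)%N, (2 * d <= sharp_n R d)%N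
    & 0 < ln (d%:R : R)].
  by near: d; exact: near_sharp_n.
have d0 : (0 : R) < d%:R by rewrite ltr0n (leq_trans _ d4).
set L : R := ln d%:R in L0 *; pose M := ln L; pose u := L / t.
have LE : L = t * u by rewrite /u mulrC divfK ?gt_eqF.
have d_r : (2 ^ r.+2 <= d)%N by near: d; exact: nbhs_infty_ge.
have L1 : 1 <= L by rewrite /L; near: d; exact: near_ln_ge.
have M0 : 0 <= M by exact: ln_ge0.
have u1 : 1 <= u.
  by rewrite ler_pdivlMr // mul1r; rewrite /L; near: d; exact: near_ln_ge.
have ur : 0 <= u - r.+1%:R.
  by rewrite subr_ge0 ler_pdivlMr //; rewrite /L; near: d; exact: near_ln_ge.
have Hu : u * C1 + C2 <= t * eta / 4 * u ^+ 2.
  have uC : (`|C1| + `|C2|) <= t * eta / 4 * u.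
    have -> : t * eta / 4 * u = L * (eta / 4) by rewrite LE; ring.
    rewrite -ler_pdivrMr ?divr_gt0 //.
    by rewrite /L; near: d; exact: near_ln_ge.
  rewrite expr2 mulrA [leRHS]mulrC.
  apply: le_trans (ler_wpM2l (le_trans ler01 u1) uC).
  rewrite [leRHS]mulrDr; apply: lerD.
    by rewrite ler_wpM2l ?ler_norm // (le_trans ler01).
  by apply: le_trans (ler_norm _) _; rewrite ler_peMl.
have M4 := ln_ge_lnln _ L0; rewrite -/M in M4.
have Mbig : `|ln c| + `|ln (2 * t * b)| + 4 * ln 4 <= 2 * M.
  by rewrite -ler_pdivrMl //; rewrite /M /L; near: d; exact: near_lnln_ge.
have lncM : 0 <= L - 2 * M + ln c.
  have := ler_norm (- ln c); rewrite normrN; have := normr_ge0 (ln (2 * t * b)).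
  lra.
have [K [KE K0 lnK']] : exists K : R,
    [/\ K = L ^+ 2 / (2 * t), 0 < K & ln K = 2 * M - h].
  exists (L ^+ 2 / (2 * t)); split=> //.
    by rewrite divr_gt0 ?exprn_gt0 ?mulr_gt0.
  rewrite ln_div ?posrE ?exprn_gt0 ?mulr_gt0 // lnXn // -/M -/h.
  by rewrite -[M *+ 2]mulr_natl.
have [k nE /andP[kK Kk]] : exists2 k, sharp_n R d = (d * 2 ^ k)%N &
    k%:R <= K < k.+1%:R.
  by exists (Num.truncn K); [rewrite KE|exact/truncn_itv/ltW].
have Ku : K = t * u ^+ 2 / 2 by rewrite KE LE; field; rewrite gt_eqF.
have kb : k%:R <= b * d%:R.
  apply: (le_trans kK); rewrite -ler_ln ?posrE ?mulr_gt0 //.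
  rewrite lnM ?posrE // -/L lnK'.
  have := ler_norm (- ln (2 * t * b)); rewrite normrN.
  have := normr_ge0 (ln c); move: Mbig M4.
  have -> : ln (2 * t * b) = h + ln b by rewrite lnM ?posrE ?mulr_gt0.
  clear; lra.
have rd : (r.+2 <= trunc_log 2 d)%N by exact: trunc_log_max.
have [a aE] : exists a, (a + r)%N = trunc_log 2 d.
  by exists (trunc_log 2 d - r)%N; rewrite subnK // ltnW // ltnW.
have a2 : (2 <= a)%N by move: rd; rewrite -aE -[r.+2]/(2 + r)%N leq_add2r.
have tld : (2 ^ trunc_log 2 d <= d)%N.
  by apply: trunc_logP => //; exact: leq_trans d4.
have ad : (2 ^ a.+1 <= d)%N.
  by apply: leq_trans tld; rewrite leq_exp2l // -aE -addn1 leq_add2l.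
have ab : 2 ^+ a <= b * d%:R.
  have : (2 ^+ a * 2 ^+ r : R) <= d%:R.
    by rewrite -exprD -natrX ler_nat aE.
  rewrite -ler_pdivlMr ?exprn_gt0 // => /le_trans -> //.
  rewrite mulrC (ler_wpM2r (ltW d0)) // -[leRHS]invrK.
  by rewrite lef_pV2 ?posrE ?invr_gt0 ?exprn_gt0.
have akd : (2 ^ a + k < d)%N.
  rewrite -(ltr_nat R) natrD natrX; apply: le_lt_trans (lerD ab kb) _.
  rewrite -mulrDl gtr_pMl // bE; move: q0; clear; lra.
have HA : t * u - eta / 4 <= ln (d - 2 ^ a - k)%:R.
  have -> : t * u - eta / 4 = ln (d%:R * q).
    by rewrite lnM ?posrE // qE expRK -LE.
  rewrite ler_ln ?posrE ?mulr_gt0 //; last by rewrite ltr0n; clear -akd; lia.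
  rewrite natrB; last by clear -akd; lia.
  rewrite natrB; last by clear -akd; lia.
  by rewrite natrX; move: ab kb; rewrite bE; clear; lra.
have HB : ln k.+1%:R <= 2 * M - h + eta / 4.
  have -> : 2 * M - h + eta / 4 = ln (K * expR (eta / 4)).
    by rewrite lnM ?posrE ?expR_gt0 // expRK lnK'.
  rewrite ler_ln ?posrE ?mulr_gt0 ?expR_gt0 ?ltr0n //.
  have Q : 1 <= K * (eta / 4).
    rewrite -ler_pdivrMr ?divr_gt0 // KE ler_pdivlMr ?mulr_gt0 //.
    apply: (@le_trans _ _ L); first by rewrite /L; near: d; exact: near_ln_ge.
    by rewrite expr2 ler_peMl // ltW.
  have : K * (1 + eta / 4) <= K * expR (eta / 4).
    by rewrite ler_pM2l // expR_ge1Dx.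
  rewrite -[k.+1%:R]natr1 mulrDr mulr1; apply: le_trans.
  exact: lerD.
have kge : t * u ^+ 2 / 2 - 1 <= k%:R.
  by rewrite -Ku; move: Kk; rewrite -[k.+1%:R]natr1; clear; lra.
have ua : u - r.+1%:R <= a%:R.
  rewrite lerBlDr -natrD ler_pdivrMr // mulr_natl -lnXn //.
  rewrite ler_ln ?posrE ?exprn_gt0 // -natrX ler_nat ltnW //.
  rewrite addnS aE; exact: trunc_log_ltn.
have ura : 0 <= u - r.+1%:R <= a%:R by rewrite ur ua.
have n1 : 1 < (sharp_n R d)%:R - d%:R :> R.
  by rewrite -natrB; [rewrite ltr1n; clear -d4 nd; lia|clear -d4 nd; lia].
have W0 : (0 : R) < (leaf_weight (d - 3) (sharp_n R d))%:R.
  by rewrite ltr0n leaf_weight_gt0 //; clear -d4 nd; lia.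
rewrite powR_log2_le_ln //.
have lnn : ln ((sharp_n R d)%:R - d%:R) <= t * (u + k%:R) :> R.
  rewrite mulrDr -LE [t * _]mulrC mulr_natl -lnXn // -lnM ?posrE ?exprn_gt0 //.
  rewrite -natrX -natrM -nE.
  rewrite ler_ln ?posrE ?ltr0n; [|exact: lt_trans n1|by clear -d4 nd; lia].
  by rewrite gerBl ler0n.
have lg : ln (c * (d%:R / L ^+ 2)) = L - 2 * M + ln c.
  rewrite lnM ?posrE ?divr_gt0 ?exprn_gt0 // ln_div ?posrE ?exprn_gt0 //.
  by rewrite lnXn // -/M -/L -[M *+ 2]mulr_natl addrC.
apply: (@le_trans _ _ ((L - 2 * M + ln c) * (u + k%:R))).
  rewrite /log2 lg -/t mulrAC ler_pdivrMr // -mulrA [_ * t]mulrC.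
  by rewrite ler_wpM2l.
have -> : ln c = t + h - eta by rewrite /eta; clear; lra.
rewrite LE.
apply: le_trans (exponent_compare _ _ _ _ _ _ _ _ _ _
  t0 eta0 M0 u1 kge (ler0n _ _) ura HA HB _) _.
  by move: Hu; rewrite /C1 /C2; clear; lra.
have := ln_leaf_weight_ge d k a a2 ad akd.
by rewrite -nE -/t -[k.+1%:R]natr1.
Unshelve. all: end_near. Qed.

(** * Leading constants *)

Lemma leading_constant_ge (c : R) (G : nat -> R) :
  leading_constant c G ->
  (forall c', 0 < c' < 4 * ln 2 ->
     \forall d \near \oo, c' * (d%:R / ln d%:R ^+ 2) <= G d) ->
  4 * ln 2 <= c.
Proof.
move=> [e [e0 GE]] Gge; rewrite leNgt; apply/negP => cl.
have l2 := ln2_gt0.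
have [c' cc' c'l] : exists2 c', c < c' & 0 < c' < 4 * ln 2.
  exists (Num.max (2 * ln 2) ((c + 4 * ln 2) / 2)).
    by rewrite lt_max; apply/orP; right; lra.
  rewrite lt_max gt_max; apply/andP; split; first by apply/orP; left; lra.
  by apply/andP; split; lra.
have e_lt : \forall d \near \oo, `|e d| < c' - c.
  by move/cvgr0Pnorm_lt : e0; apply; rewrite subr_gt0.
have Gc' := Gge _ c'l.
have : \forall d \near \oo, False.
  near=> d.
  have [d4 _ L0] : [/\ (4 <= d)%N, (2 * d <= sharp_n R d)%N
    & 0 < ln (d%:R : R)].
    by near: d; exact: near_sharp_n.
  have B0 : 0 < d%:R / ln d%:R ^+ 2 :> R.
    by rewrite divr_gt0 ?exprn_gt0 // ltr0n; lia.
  have ed : `|e d| < c' - c by near: d.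
  have GdE : G d = (c + e d) * (d%:R / ln d%:R ^+ 2) by near: d; exact: GE.
  have : c' * (d%:R / ln d%:R ^+ 2) <= G d by near: d.
  rewrite GdE ler_pM2r // => le; have := ler_norm (e d); lra.
by move/filter_ex => [].
Unshelve. all: end_near. Qed.

(** Capping [H] at [4 * ln 2 * d / (ln d) ^ 2] replaces a choice of constants
[c] that tend to [4 * ln 2] slowly enough. *)
Lemma leading_constant_min (H : nat -> R) :
  (forall c, 0 < c < 4 * ln 2 ->
     \forall d \near \oo, c * (d%:R / ln d%:R ^+ 2) <= H d) ->
  leading_constant (4 * ln 2)
    (fun d => Num.min (4 * ln 2 * (d%:R / ln d%:R ^+ 2)) (H d)).
Proof.
move=> Hge; set G := (fun d => _).
have l2 := ln2_gt0.
have B0 : \forall d \near \oo, 0 < d%:R / ln d%:R ^+ 2 :> R.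
  near=> d.
  have [d4 _ L0] : [/\ (4 <= d)%N, (2 * d <= sharp_n R d)%N
    & 0 < ln (d%:R : R)].
    by near: d; exact: near_sharp_n.
  by rewrite divr_gt0 ?exprn_gt0 // ltr0n; lia.
exists (fun d => G d / (d%:R / ln d%:R ^+ 2) - 4 * ln 2); split; last first.
  near=> d; have Bd : 0 < d%:R / ln d%:R ^+ 2 :> R by near: d.
  by rewrite addrC subrK divfK // gt_eqF.
apply/cvgr0Pnorm_le => eps eps0.
have [c c_ge cl] : exists2 c : R, 4 * ln 2 - eps <= c & 0 < c < 4 * ln 2.
  exists (Num.max (2 * ln 2) (4 * ln 2 - eps)).
    by rewrite le_max lexx orbT.
  rewrite lt_max gt_max; apply/andP; split; first by apply/orP; left; lra.
  by apply/andP; split; lra.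
near=> d; have Bd : 0 < d%:R / ln d%:R ^+ 2 :> R by near: d.
rewrite ler_norml; apply/andP; split.
  rewrite lerBrDr ler_pdivlMr // /G le_min; apply/andP; split.
    by rewrite ler_pM2r //; lra.
  apply: (@le_trans _ _ (c * (d%:R / ln d%:R ^+ 2))); last first.
    by near: d; exact: (Hge _ cl).
  by rewrite ler_pM2r // addrC.
rewrite lerBlDr ler_pdivrMr // /G ge_min; apply/orP; left.
by rewrite ler_pM2r //; lra.
Unshelve. all: end_near. Qed.

End Asymptotics.

Theorem theorem17 (R : realType) :
  (exists G : nat -> R, leading_constant (4 * ln 2) G /\
     \forall d \near \oo,
       exists F : set (seq nat), F `<=` leaves R d (sharp_n R d) /\
         ((curved_path_power G d (sharp_n R d))%:E
            <= total_contribution R d (sharp_n R d) F)%E)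
  /\
  (forall (c : R) (G : nat -> R) (U : nat -> nat -> \bar R),
     positive_count U ->
     (\forall d \near \oo, 0 < G d /\
        forall n : nat, (2 * d <= n)%N ->
          (U d n <= (curved_path_power G d n)%:E)%E) ->
     leading_constant c G ->
     4 * ln 2 <= c).
Proof.
have l2 := ln2_gt0 R.
pose B d : R := d%:R / ln d%:R ^+ 2.
pose X d : R := (sharp_n R d)%:R - d%:R.
pose W d : R := (leaf_weight (d - 3) (sharp_n R d))%:R.
have basic : \forall d \near \oo, [/\ (4 <= d)%N,
    (2 * d <= sharp_n R d)%N, 0 < B d, 1 < X d & 0 < W d].
  near=> d.
  have [d4 nd L0] : [/\ (4 <= d)%N, (2 * d <= sharp_n R d)%N
    & 0 < ln (d%:R : R)].
    by near: d; exact: near_sharp_n.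
  split=> //; first by rewrite divr_gt0 ?exprn_gt0 // ltr0n; lia.
    by rewrite /X -natrB; [rewrite ltr1n; lia|lia].
  by rewrite ltr0n leaf_weight_gt0 //; lia.
split.
  pose H d := expR (ln 2 * (ln (W d) / ln (X d))).
  exists (fun d => Num.min (4 * ln 2 * B d) (H d)); split.
    apply: leading_constant_min => c cl; near=> d.
    have [d4 nd B0 X1 W0] : [/\ (4 <= d)%N,
      (2 * d <= sharp_n R d)%N, 0 < B d, 1 < X d & 0 < W d] by near: d.
    rewrite -powR_log2_leE //; last first.
      by case/andP: (cl) => c0 _; rewrite mulr_gt0.
    by near: d; exact: (near_curved_path_power_le _ _ cl).
  near=> d; exists (leaves R d (sharp_n R d)); split=> //.
  have [d4 nd B0 X1 W0] : [/\ (4 <= d)%N,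
    (2 * d <= sharp_n R d)%N, 0 < B d, 1 < X d & 0 < W d] by near: d.
  apply: le_trans (total_contribution_ge _ _ _ d4 _); last by lia.
  rewrite lee_fin powR_log2_leE //; first by rewrite ge_min lexx orbT.
  by rewrite lt_min expR_gt0 andbT mulr_gt0 // mulr_gt0.
move=> c G U cnt UG /leading_constant_ge; apply=> c' c'l; near=> d.
have [d4 nd B0 X1 W0] : [/\ (4 <= d)%N,
  (2 * d <= sharp_n R d)%N, 0 < B d, 1 < X d & 0 < W d] by near: d.
have [Gd /(_ _ nd) UGd] : 0 < G d /\ forall n : nat, (2 * d <= n)%N ->
    (U d n <= (curved_path_power G d n)%:E)%E by near: d.
have cW : X d `^ log2 (c' * B d) <= W d.
  by near: d; exact: (near_curved_path_power_le _ _ c'l).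
have WG : W d <= X d `^ log2 (G d).
  rewrite -lee_fin; apply: le_trans UGd; apply: le_trans (cnt _ _ d4 nd).
  by apply: total_contribution_ge => //; lia.
have := le_trans cW WG; rewrite powR_log2_le_ln ?powR_gt0 //; last by lra.
rewrite ln_powR ler_pM2r ?ln_gt0 // /log2 ler_pM2r ?invr_gt0 //.
by rewrite ler_ln ?posrE // mulr_gt0 //; case/andP: (c'l).
Unshelve. all: end_near. Qed.
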